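(* Let $\mathcal X,\mathcal Y,\mathcal Z$ be finite sets, $f\colon\mathcal X\times\mathcal Y\to\mathcal Z$ arbitrary, and $\mu$ a distribution on $\mathcal X\times\mathcal Y$. The following are equivalent: (a) $\mu$ is internal-trivial; (b) $\mu$ is strongly internal-trivial; (c) $\mu$ is structurally internal-trivial.
   Context: Two-party randomized protocols with public and private randomness; transcript $\Pi$ consists of public randomness and exchanged bits. For $(X,Y)\sim\mu$, $\mathrm{IC}_\mu(\pi)=I(\Pi;X\mid Y)+I(\Pi;Y\mid X)$; $\mathrm{IC}_\mu(f,0)$ is the infimum of $\mathrm{IC}_\mu(\pi)$ over protocols computing $f$ correctly with probability 1 on every input. $\mu$ is internal-trivial if $\mathrm{IC}_\mu(f,0)=0$; strongly internal-trivial if some protocol $\pi$ computing $f$ correctly on all inputs has $\mathrm{IC}_\mu(\pi)=0$; structurally internal-trivial if, letting $S_A\subseteq\mathcal X$ and $S_B\subseteq\mathcal Y$ be the supports of the marginals of $\mu$, there are partitions $S_A=\bigcup_i\mathcal X_i$ and $S_B=\bigcup_i\mathcal Y_i$ (same index set) such that $\mathrm{supp}\,\mu\subseteq\bigcup_i\mathcal X_i\times\mathcal Y_i$ and $f$ is constant on each $\mathcal X_i\times\mathcal Y_i$. *)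

(* Defs.v *)
From HB Require Import structures.
From mathcomp Require Import all_boot all_order all_algebra.
From mathcomp Require Import all_classical all_reals all_analysis.

Set Implicit Arguments.
Unset Strict Implicit.
Unset Printing Implicit Defensive.

Import Order.TTheory GRing.Theory Num.Theory.

Local Open Scope classical_set_scope.
Local Open Scope ring_scope.

Section Information.
Variable R : realType.

Definition is_distribution (T : finType) (p : T -> R) : Prop :=
  (forall t, 0 <= p t) /\ \sum_t p t = 1.

Definition log2 (x : R) : R := ln x / ln 2.

(* [ln 0 = 0] in the library, so null atoms contribute 0. *)
Definition entropy (A : finType) (p : A -> R) : R :=
  - \sum_a p a * log2 (p a).

(* H(A | B) = \sum_b Pr[B = b] H(A | B = b) for the joint mass function [p];
   a null [b] contributes 0 whatever the value of [_ / 0]. *)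
Definition cond_entropy (A B : finType) (p : A -> B -> R) : R :=
  \sum_b (\sum_a p a b) * entropy (fun a => p a b / \sum_a' p a' b).

(* I(A; B | C) = H(A | C) - H(A | B, C) *)
Definition cond_mutual_info (A B C : finType) (p : A -> B -> C -> R) : R :=
  cond_entropy (fun a c => \sum_b p a b c)
  - cond_entropy (fun a (bc : B * C) => p a bc.1 bc.2).

End Information.

Inductive player := Alice | Bob.

(* The public random string and the two private ones are independent and range
   over arbitrary probability spaces.  After the bits [h] have been exchanged
   under the public string [r], [turn h r] is the player who sends the next
   bit, or [None] if the communication is over; at most [depth] bits are ever
   exchanged.  The output is read off the transcript. *)
Record protocol (R : realType) (X Y Z : finType) := Protocol {
  pub_disp : measure_display;
  privA_disp : measure_display;
  privB_disp : measure_display;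
  pubT : measurableType pub_disp;
  privAT : measurableType privA_disp;
  privBT : measurableType privB_disp;
  pubP : probability pubT R;
  privAP : probability privAT R;
  privBP : probability privBT R;
  depth : nat;
  turn : seq bool -> pubT -> option player;
  sendA : X -> seq bool -> pubT * privAT -> bool;
  sendB : Y -> seq bool -> pubT * privBT -> bool;
  output : seq bool -> pubT -> Z;
  turn_depth : forall h r, (depth <= size h)%N -> turn h r = None;
  turn_measurable : forall h o, measurable (turn h @^-1` [set o]);
  sendA_measurable : forall x h b, measurable (sendA x h @^-1` [set b]);
  sendB_measurable : forall y h b, measurable (sendB y h @^-1` [set b]);
  output_measurable : forall h z, measurable (output h @^-1` [set z])
}.

Section Protocols.
Variables (R : realType) (X Y Z : finType) (pi : protocol R X Y Z).

Definition coins : Type := pubT pi * (privAT pi * privBT pi).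

Definition Pr (E : set coins) : R :=
  fine ((pubP pi \x (privAP pi \x privBP pi))%E E).

Fixpoint run (x : X) (y : Y) (w : coins) (n : nat) (h : seq bool) : seq bool :=
  if n is n'.+1 then
    match turn h w.1 with
    | None => h
    | Some Alice => run x y w n' (rcons h (sendA x h (w.1, w.2.1)))
    | Some Bob => run x y w n' (rcons h (sendB y h (w.1, w.2.2)))
    end
  else h.

Definition transcript (x : X) (y : Y) (w : coins) : pubT pi * seq bool :=
  (w.1, run x y w (depth pi) [::]).

Definition result (x : X) (y : Y) (w : coins) : Z :=
  output (transcript x y w).2 (transcript x y w).1.

Definition computes (f : X -> Y -> Z) : Prop :=
  forall x y, Pr [set w | result x y w = f x y] = 1.

(* A finite measurable partition of the space of transcripts, presented as a
   labelling; [seq bool] carries the discrete sigma-algebra. *)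
Definition quantizer (k : nat) (q : pubT pi * seq bool -> 'I_k) : Prop :=
  forall h i, measurable [set r | q (r, h) = i].

Variable mu : X * Y -> R.

Definition quantized_law (k : nat) (q : pubT pi * seq bool -> 'I_k)
    (i : 'I_k) (x : X) (y : Y) : R :=
  mu (x, y) * Pr [set w | q (transcript x y w) = i].

(* The public string need not be discrete, so the mutual information with the
   transcript is the supremum over the finite quantizations of the transcript;
   for discrete transcripts this is the elementary formula. *)
Definition info_X_given_Y : \bar R :=
  ereal_sup [set v | exists k (q : pubT pi * seq bool -> 'I_k), quantizer q /\
    v = (cond_mutual_info (fun i x y => quantized_law q i x y))%:E].

Definition info_Y_given_X : \bar R :=
  ereal_sup [set v | exists k (q : pubT pi * seq bool -> 'I_k), quantizer q /\
    v = (cond_mutual_info (fun i y x => quantized_law q i x y))%:E].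

Definition internal_cost : \bar R := (info_X_given_Y + info_Y_given_X)%E.

End Protocols.

Section Triviality.
Variables (R : realType) (X Y Z : finType) (f : X -> Y -> Z) (mu : X * Y -> R).

(* IC_mu(f, 0) *)
Definition internal_complexity : \bar R :=
  ereal_inf [set v | exists pi : protocol R X Y Z,
    computes pi f /\ v = internal_cost pi mu].

Definition internal_trivial : Prop := internal_complexity = 0%E.

Definition strongly_internal_trivial : Prop :=
  exists pi : protocol R X Y Z, computes pi f /\ internal_cost pi mu = 0%E.

Definition support_A : {set X} := [set x | \sum_y mu (x, y) != 0]%SET.
Definition support_B : {set Y} := [set y | \sum_x mu (x, y) != 0]%SET.

Definition is_indexed_partition (I T : finType) (P : I -> {set T}) (S : {set T}) :
    Prop :=
  [/\ forall i, P i != finset.set0,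
      forall i j, i != j -> (P i :&: P j)%SET = finset.set0 &
      (\bigcup_(i : I) P i)%SET = S].

Definition structurally_internal_trivial : Prop :=
  exists (k : nat) (XX : 'I_k -> {set X}) (YY : 'I_k -> {set Y}),
  [/\ is_indexed_partition XX support_A,
      is_indexed_partition YY support_B,
      forall x y, mu (x, y) != 0 -> exists i, x \in XX i /\ y \in YY i &
      forall i x x' y y', x \in XX i -> x' \in XX i ->
        y \in YY i -> y' \in YY i -> f x y = f x' y'].

End Triviality.

(* Main.v *)
Require Import Defs.
From mathcomp Require Import all_boot all_order all_algebra.
From mathcomp Require Import all_classical all_reals all_analysis.
From mathcomp Require Import measurable_realfun.
From mathcomp Require Import zify ring lra.

(** Take a connected component of the bipartite graph [supp mu] and a protocol
    of tiny cost.  Along an edge path, each step keeps [x] or [y], so by a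
    Pinsker-type inequality the law of the transcript hardly changes: it is
    nearly constant on the edges of the component.  Given the public string,
    the probability of a transcript is a product [a_x b_y].  For an arbitrary
    pair [(x, y)] of the rectangle spanned by the component, the transcripts
    with [a_x > 0], and those with [b_y > 0], have probability one at some
    edge, hence probability close to one at a fixed edge [u].  If
    [f x y <> f u], the transcripts with output [f u] are null at [(x, y)], so
    those among them with [a_x b_y > 0] come from a null set of public strings
    and are null at [u] too, a contradiction.  Hence [f] is constant on the
    rectangle.  Conversely, given blocks, announcing them reveals nothing on the
    support of [mu], and inputs are exchanged only if the blocks differ. *)

Set Implicit Arguments.
Unset Strict Implicit.
Unset Printing Implicit Defensive.

Import Order.TTheory GRing.Theory Num.Theory.

Local Open Scope classical_set_scope.
Local Open Scope ring_scope.

(** * Rectangles of coins *)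

Section CoinRectangles.
Context d1 d2 d3 (T1 : measurableType d1) (T2 : measurableType d2)
  (T3 : measurableType d3) (R : realType).
Variables (P1 : probability T1 R) (P2 : probability T2 R)
  (P3 : probability T3 R).
Local Notation P := (P1 \x (P2 \x P3))%E.
Implicit Types (D : set T1) (A : set (T1 * T2)) (B : set (T1 * T3)).

(** The shape of the events that fix the exchanged bits: each private string is constrained only
    jointly with the public one. *)
Definition coin_rect D A B : set (T1 * (T2 * T3)) :=
  [set w | [/\ D w.1, A (w.1, w.2.1) & B (w.1, w.2.2)]].

Lemma measurable_coin_rect D A B : measurable D -> measurable A ->
  measurable B -> measurable (coin_rect D A B).
Proof.
move=> mD mA mB.
have -> : coin_rect D A B = fst @^-1` D `&`
    ((fun w : T1 * (T2 * T3) => (w.1, w.2.1)) @^-1` A `&`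
     (fun w : T1 * (T2 * T3) => (w.1, w.2.2)) @^-1` B).
  by apply/seteqP; split => w /=; [case|case=> ? []].
apply: measurableI; last apply: measurableI.
- rewrite -[X in measurable X]setTI.
  exact: (@measurable_fst _ _ T1 (T2 * T3)%type).
- rewrite -[X in measurable X]setTI.
  apply: (measurable_fun_pair _ _) => //.
  exact: (measurableT_comp measurable_fst measurable_snd).
- rewrite -[X in measurable X]setTI.
  apply: (measurable_fun_pair _ _) => //.
  exact: (measurableT_comp measurable_snd measurable_snd).
Qed.

Lemma coin_rect_xsection D A B r : D r ->
  xsection (coin_rect D A B) r = xsection A r `*` xsection B r.
Proof.
move=> Dr; apply/seteqP; split => w; rewrite /xsection/coin_rect /= !inE /=.
  by case.
by case.
Qed.

Lemma coin_rect_xsection0 D A B r : ~ D r ->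
  xsection (coin_rect D A B) r = set0.
Proof.
move=> Dr; apply/seteqP; split => w //; rewrite /xsection/coin_rect /= !inE /=.
by case.
Qed.

(** Once the public string is fixed, the private strings are independent. *)
Lemma coin_rect_slice D A B r : measurable A -> measurable B -> D r ->
  (P2 \x P3)%E (xsection (coin_rect D A B) r) =
  (P2 (xsection A r) * P3 (xsection B r))%E.
Proof.
move=> mA mB Dr; rewrite coin_rect_xsection// product_measure1E//;
exact: measurable_xsection.
Qed.

Let coin_measureE (E : set (T1 * (T2 * T3))) :
  P E = (\int[P1]_r (P2 \x P3) (xsection E r))%E.
Proof. by []. Qed.

Lemma coin_rect_null D A B : measurable A -> measurable B ->
  (forall r, D r -> P2 (xsection A r) = 0%E \/ P3 (xsection B r) = 0%E) ->
  P (coin_rect D A B) = 0%E.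
Proof.
move=> mA mB null; rewrite coin_measureE.
apply: integral0_eq => r _.
have [Dr|Dr] := pselect (D r); last by rewrite coin_rect_xsection0// measure0.
by rewrite coin_rect_slice//; case: (null r Dr) => ->; rewrite ?mul0e ?mule0.
Qed.

(* Absolute continuity across inputs: a null rectangle lives, up to a null set
   of public strings, where one of its two private sections is null. *)
Lemma coin_rect_null_trans D A B A' B' : measurable D -> measurable A ->
  measurable B -> measurable A' -> measurable B' ->
  P (coin_rect D A B) = 0%E ->
  P (coin_rect [set r | [/\ D r, (0 < P2 (xsection A r))%E
    & (0 < P3 (xsection B r))%E]] A' B') = 0%E.
Proof.
move=> mD mA mB mA' mB' P0.
set D' := [set r | _].
have mE := measurable_coin_rect mD mA mB.
pose P23 : probability (T2 * T3)%type R := (P2 \x P3)%E.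
have mS := measurable_fun_xsection P23 mE.
(* A nonnegative function with zero integral vanishes almost everywhere; here it is the measure of
   the slice over [r]. *)
have : ae_eq P1 setT ((P2 \x P3)%E \o xsection (coin_rect D A B)) (cst 0%E).
  apply: (proj1 (ae_eq_integral_abs P1 measurableT mS)).
  rewrite -[RHS]P0 coin_measureE; apply: eq_integral => r _ /=.
  by rewrite gee0_abs.
case=> N [mN N0 sN].
have D'N : D' `<=` N.
  move=> r [Dr a0 b0]; apply: sN => /= /(_ I).
  rewrite coin_rect_slice// => /eqP; rewrite mule_eq0 => /orP[] /eqP ab.
    by rewrite ab ltxx in a0.
  by rewrite ab ltxx in b0.
(* The new rectangle lies over [N], whatever [A'] and [B'] are. *)
have mNT : measurable (N `*` (setT : set (T2 * T3))) by exact: measurableX.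
pose PP : probability (T1 * (T2 * T3))%type R := P.
apply: (@subset_measure0 _ _ _ PP _ (N `*` setT)).
- apply: measurable_coin_rect => //.
  have mpos d (T : measurableType d) (Q : probability T R) (C : set (T1 * T)) :
      measurable C -> measurable [set r | (0 < Q (xsection C r))%E].
    move=> mC; rewrite -[X in measurable X]setTI.
    apply: emeasurable_fun_o_infty => //; exact: measurable_fun_xsection.
  have -> : D' = D `&` ([set r | (0 < P2 (xsection A r))%E] `&`
      [set r | (0 < P3 (xsection B r))%E]).
    by apply/seteqP; split => r /=; [case|case=> ? []].
  apply: measurableI => //; apply: measurableI; exact: mpos.
- exact: mNT.
- by move=> w /= [/D'N Nw _ _].
- transitivity (P1 N * P23 setT)%E; last by rewrite N0 mul0e.
  exact: (product_measure1E P1 P23 mN measurableT).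
Qed.

End CoinRectangles.

(** * Mutual information and one-step stability *)

Section InformationBounds.
Variable R : realType.

Lemma ln2_gt0 : 0 < ln 2 :> R.
Proof. by rewrite ln_gt0// ltr1n. Qed.

(* Substitute [a = sqrt t], [b = sqrt s] and use [ln (b / a) <= b / a - 1]. *)
Lemma divergence_ge (s t : R) : 0 <= t <= 1 -> 0 <= s <= 1 ->
  (0 < t -> 0 < s) ->
  t - s + (t - s) ^+ 2 / 4 <= t * (ln t - ln s).
Proof.
move=> /andP[t0 t1] /andP[s0 s1] ts.
have [t_gt0|t_le0] := ltP 0 t; last first.
  have -> : t = 0 by apply/eqP; rewrite eq_le t0 t_le0.
  nra.
have {ts} s_gt0 := ts t_gt0.
set a := Num.sqrt t; set b := Num.sqrt s.
have a_gt0 : 0 < a by rewrite sqrtr_gt0.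
have b_gt0 : 0 < b by rewrite sqrtr_gt0.
have ta : t = a ^+ 2 by rewrite sqr_sqrtr.
have sb : s = b ^+ 2 by rewrite sqr_sqrtr.
have a1 : a <= 1 by rewrite -sqrtr1 ler_wsqrtr.
have b1 : b <= 1 by rewrite -sqrtr1 ler_wsqrtr.
have lnab : ln b - ln a <= b / a - 1.
  rewrite -ln_div// -{1}(subrKC 1 (b / a)); apply: le_ln1Dx.
  by rewrite ltrBrDl subrr divr_gt0.
have {}lnab : a ^+ 2 * (ln b - ln a) <= a * b - a ^+ 2.
  have -> : a * b - a ^+ 2 = a ^+ 2 * (b / a - 1).
    by field; rewrite gt_eqF.
  by rewrite ler_pM2l ?exprn_gt0.
(* The constant 4 comes from [a + b <= 2]. *)
have sq_le : (a ^+ 2 - b ^+ 2) ^+ 2 <= (a - b) ^+ 2 * 4.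
  rewrite subr_sqr exprMn ler_wpM2l ?sqr_ge0//.
  have -> : 4 = 2 ^+ 2 :> R by ring.
  by rewrite lerXn2r ?nnegrE//; lra.
(* The two bounds combine through [2 (a^2 - a b) = (a^2 - b^2) + (a - b)^2]. *)
rewrite ta sb !lnXn// -[ln a *+ 2]mulr_natl -[ln b *+ 2]mulr_natl.
move: lnab sq_le; set u := ln a; set v := ln b => lnab sq_le.
have -> : a ^+ 2 * (2 * u - 2 * v) = - 2 * (a ^+ 2 * (v - u)) by ring.
have {}sq_le : (a ^+ 2 - b ^+ 2) ^+ 2 / 4 <= (a - b) ^+ 2.
  by rewrite ler_pdivrMr.
have sqE : (a - b) ^+ 2 = a ^+ 2 - 2 * (a * b) + b ^+ 2 by ring.
rewrite sqE in sq_le; lra.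
Qed.

Lemma ratio_sum_itv (A : finType) (p : A -> R) a : (forall a, 0 <= p a) ->
  0 <= p a / \sum_a' p a' <= 1.
Proof.
move=> p0; have S0 : 0 <= \sum_a' p a' by exact: sumr_ge0.
rewrite divr_ge0//=; have [->|Sn0] := eqVneq (\sum_a' p a') 0.
  by rewrite invr0 mulr0.
rewrite ler_pdivrMr ?lt0r ?Sn0// mul1r (bigD1 a)//= lerDl.
exact: sumr_ge0.
Qed.

Lemma cond_entropyE (A B : finType) (p : A -> B -> R) :
  (forall a b, 0 <= p a b) ->
  cond_entropy p * ln 2 =
  - \sum_b \sum_a p a b * ln (p a b / \sum_a' p a' b).
Proof.
move=> p0; rewrite /cond_entropy mulr_suml -sumrN; apply: eq_bigr => b _.
rewrite /entropy mulrN mulNr; congr (- _).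
rewrite mulr_sumr mulr_suml; apply: eq_bigr => a _.
(* Over a null [b] every [p a b] vanishes, so the division by 0 is harmless. *)
have [S0|Sn0] := eqVneq (\sum_a p a b) 0.
  have -> : p a b = 0 by apply: (psumr_eq0P _ S0).
  by rewrite !mul0r !(mulr0,mul0r).
by rewrite /log2; field; rewrite Sn0 gt_eqF// ln2_gt0.
Qed.

Lemma cond_entropy_determined (A B : finType) (p : A -> B -> R) :
  (forall b, exists c, forall a, p a b != 0 -> a = c) -> cond_entropy p = 0.
Proof.
move=> pdet; apply: big1 => b _; have [c pc] := pdet b.
have p0 a : a != c -> p a b = 0 by move=> ac; apply: contraNeq ac => /pc ->.
have -> : \sum_a p a b = p c b by rewrite (bigD1 c)//= big1 ?addr0.
rewrite /entropy big1 ?oppr0 ?mulr0// => a _; rewrite /log2.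
have [->|/p0 ->] := eqVneq a c; last by rewrite !mul0r.
have [->|pn0] := eqVneq (p c b) 0; first by rewrite !mul0r.
by rewrite divff// ln1 mul0r mulr0.
Qed.

(** * Mutual information of a channel with side information *)

Section Channel.
Variables (I B C : finType) (m : B -> C -> R) (P : I -> B -> C -> R).
Hypotheses (m0 : forall b c, 0 <= m b c) (P0 : forall i b c, 0 <= P i b c)
  (P1 : forall b c, \sum_i P i b c = 1).

Let law i b c := m b c * P i b c.
(** The conditional law of the output given [c] alone, with [b] averaged out. *)
Let mix i c := (\sum_b m b c * P i b c) / \sum_b m b c.

Let law_ge0 i b c : 0 <= law i b c. Proof. exact: mulr_ge0. Qed.

Let lawE b c : \sum_i law i b c = m b c.
Proof. by rewrite -mulr_sumr P1 mulr1. Qed.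

Let law_margE c : \sum_i \sum_b law i b c = \sum_b m b c.
Proof. by rewrite exchange_big; apply: eq_bigr => b _; exact: lawE. Qed.

(** The mutual information is the average over [(b, c)] of the divergence of [P _ b c] from
    [mix _ c]. Each divergence dominates a sum of squares, of which a single term is kept. *)
Lemma cond_mutual_info_ge b c i :
  m b c * (P i b c - mix i c) ^+ 2 / 4 <= cond_mutual_info law * ln 2.
Proof.
have P_itv j b' c' : 0 <= P j b' c' <= 1.
  rewrite P0 /= -(P1 b' c') (bigD1 j)//= lerDl; exact: sumr_ge0.
have mix_itv j c' : 0 <= mix j c' <= 1.
  have := @ratio_sum_itv _ (fun j => \sum_b law j b c') j.
  rewrite law_margE; apply=> k; exact: sumr_ge0.
pose D j b' c' := P j b' c' * (ln (P j b' c') - ln (mix j c')).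
have -> : cond_mutual_info law * ln 2 =
    \sum_b' \sum_c' m b' c' * \sum_j D j b' c'.
  rewrite /cond_mutual_info mulrBl !cond_entropyE//; last first.
    by move=> *; exact: sumr_ge0.
  rewrite opprK addrC.
  rewrite -(pair_bigA _ (fun b' c' => \sum_j law j b' c' *
     ln (law j b' c' / \sum_a' law a' b' c'))) /=.
  have -> : \sum_c' \sum_j (\sum_b' law j b' c') *
      ln ((\sum_b' law j b' c') / \sum_a' \sum_b' law a' b' c') =
      \sum_b' \sum_c' \sum_j law j b' c' * ln (mix j c').
    rewrite [RHS]exchange_big /=; apply: eq_bigr => c' _.
    rewrite [RHS]exchange_big /=; apply: eq_bigr => j _.
    by rewrite law_margE mulr_suml.
  rewrite -sumrB; apply: eq_bigr => b' _; rewrite -sumrB.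
  apply: eq_bigr => c' _; rewrite -sumrB mulr_sumr; apply: eq_bigr => j _.
  rewrite lawE /law /D; have [->|mn0] := eqVneq (m b' c') 0.
    by rewrite !mul0r subr0.
  by rewrite [X in ln X]mulrC mulKf// -mulrBr mulrA.
have D_ge j b' c' : m b' c' * (P j b' c' - mix j c' +
    (P j b' c' - mix j c') ^+ 2 / 4) <= m b' c' * D j b' c'.
  have [->|mn0] := eqVneq (m b' c') 0; first by rewrite !mul0r.
  have m_gt0 : 0 < m b' c' by rewrite lt0r mn0 m0.
  (* Absolute continuity: an output that is possible at a pair of positive weight has positive mass
     in the mixture. *)
  rewrite ler_pM2l//; apply: divergence_ge => // t0; apply: divr_gt0.
    rewrite (bigD1 b')//= ltr_pwDl ?mulr_gt0//.
    by apply: sumr_ge0 => *; exact: mulr_ge0.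
  by rewrite (bigD1 b')//= ltr_pwDl ?mulr_gt0//; apply: sumr_ge0.
(* The linear terms cancel in the sum over [j], since both laws have total mass 1. *)
have mD_ge b' c' : \sum_j m b' c' * ((P j b' c' - mix j c') ^+ 2 / 4) <=
    m b' c' * \sum_j D j b' c'.
  have [->|mn0] := eqVneq (m b' c') 0.
    by rewrite mul0r big1// => j _; rewrite mul0r.
  have mix1 : \sum_j mix j c' = 1.
    rewrite -mulr_suml law_margE divff// gt_eqF//.
    rewrite (bigD1 b')//= ltr_pwDl// ?lt0r ?mn0 ?m0//; exact: sumr_ge0.
  rewrite mulr_sumr; apply: le_trans (ler_sum _ (fun j _ => D_ge j b' c')).
  under [leRHS]eq_bigr do rewrite mulrDr mulrBr.
  by rewrite big_split/= sumrB -!mulr_sumr P1 mix1 subrr add0r.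
have sq_ge0 j b' c' : 0 <= m b' c' * ((P j b' c' - mix j c') ^+ 2 / 4).
  by rewrite mulr_ge0// divr_ge0 ?sqr_ge0.
apply: le_trans (ler_sum _ (fun b' _ => ler_sum _ (fun c' _ => mD_ge b' c'))).
rewrite (bigD1 b)//= (bigD1 c)//= (bigD1 i)//= -mulrA -!addrA lerDl.
by rewrite !addr_ge0 ?sumr_ge0// => *; rewrite ?sumr_ge0// => *;
  rewrite ?sumr_ge0.
Qed.

(** Both [P i b c] and [P i b' c] are within [d] of the same mixture [mix i c]. *)
Lemma channel_stable (e d k : R) b b' c i :
  cond_mutual_info law <= e -> 4 * (e * ln 2) <= k * d ^+ 2 -> 0 < k ->
  0 <= d -> k <= m b c -> k <= m b' c ->
  `|P i b c - P i b' c| <= 2 * d.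
Proof.
move=> cmi_e e_kd k0 d0.
have close b0 : k <= m b0 c -> `|P i b0 c - mix i c| <= d.
  move=> kb0; have := cond_mutual_info_ge b0 c i.
  set u := P i b0 c - mix i c => ge_u.
  have : cond_mutual_info law * ln 2 <= e * ln 2.
    by rewrite ler_pM2r ?ln2_gt0.
  have : k * u ^+ 2 <= m b0 c * u ^+ 2 by rewrite ler_wpM2r ?sqr_ge0.
  move=> ku cmi_ln; have : k * u ^+ 2 <= k * d ^+ 2 by lra.
  rewrite ler_pM2l// -real_normK ?num_real// ler_pXn2r ?nnegrE//.
move=> /close + /close; rewrite !ler_norml; lra.
Qed.

End Channel.

End InformationBounds.

(** * Transcripts as rectangles *)

Lemma measure_countable_bigcup0 d (T : measurableType d) (R : realType)
    (P : {measure set T -> \bar R}) (I : countType) (F : I -> set T) :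
  (forall i, measurable (F i)) -> (forall i, P (F i) = 0%E) ->
  P (\bigcup_i F i) = 0%E.
Proof.
move=> mF F0; pose G n := if unpickle n is Some i then F i else set0.
have -> : \bigcup_i F i = \bigcup_n G n.
  apply/seteqP; split=> t [i _ Fit].
    by exists (pickle i) => //; rewrite /G pickleK.
  by move: Fit; rewrite /G; case: unpickle => // j Fjt; exists j.
have mG n : measurable (G n) by rewrite /G; case: unpickle.
apply: measure_negligible; first exact: bigcupT_measurable.
apply: negligible_bigcup => n; apply/negligibleP => //.
by rewrite /G; case: unpickle.
Qed.

Section FineProbability.
Context d (T : measurableType d) (R : realType).
Variable P : probability T R.
Implicit Types A B : set T.

Let fineP A : measurable A -> (fine (P A))%:E = P A.
Proof. by move=> mA; rewrite fineK// fin_num_measure. Qed.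

Lemma fine_probability_setC A : measurable A ->
  fine (P (~` A)) = 1 - fine (P A).
Proof.
move=> mA; apply: EFin_inj; rewrite EFinB !fineP//; last exact: measurableC.
exact: probability_setC.
Qed.

Lemma fine_probabilityU A B : measurable A -> measurable B ->
  fine (P (A `|` B)) <= fine (P A) + fine (P B).
Proof.
move=> mA mB; rewrite -lee_fin EFinD !fineP//; last exact: measurableU.
exact: measureU2.
Qed.

Lemma le_fine_probability A B : measurable A -> measurable B -> A `<=` B ->
  fine (P A) <= fine (P B).
Proof. by move=> mA mB AB; rewrite -lee_fin !fineP// le_measure ?inE. Qed.

Lemma fine_probability_eq0 A : measurable A -> fine (P A) = 0 -> P A = 0%E.
Proof. by move=> mA PA0; rewrite -fineP// PA0. Qed.

End FineProbability.

Section ProtocolRectangles.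
Variables (R : realType) (X Y Z : finType) (pi : protocol R X Y Z).
Implicit Types (x : X) (y : Y) (g h s : seq bool).

(* [s] is the sequence of bits exchanged, within a budget of [n], after the
   history [g]; the three conditions single out the coins for which this
   happens, and each player's bits only constrain that player's coins. *)
Fixpoint live n g s : set (pubT pi) :=
  match n, s with
  | 0%N, [::] => setT
  | 0%N, _ :: _ => set0
  | _.+1, [::] => [set r | turn g r = None]
  | n'.+1, b :: s' => [set r | turn g r <> None] `&` live n' (rcons g b) s'
  end.

Fixpoint agreeA x g s : set (pubT pi * privAT pi) :=
  if s is b :: s' then
    [set w | turn g w.1 = Some Alice -> sendA x g w = b] `&`
    agreeA x (rcons g b) s'
  else setT.

Fixpoint agreeB y g s : set (pubT pi * privBT pi) :=
  if s is b :: s' then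
    [set w | turn g w.1 = Some Bob -> sendB y g w = b] `&`
    agreeB y (rcons g b) s'
  else setT.

Lemma run_extends x y w n g : exists s, run x y (w : coins pi) n g = g ++ s.
Proof.
elim: n g => [|n IHn] g /=; first by exists [::]; rewrite cats0.
case: (turn g w.1) => [[]|]; last by exists [::]; rewrite cats0.
- by have [s ->] := IHn (rcons g (sendA x g (w.1, w.2.1)));
    eexists; rewrite cat_rcons.
- by have [s ->] := IHn (rcons g (sendB y g (w.1, w.2.2)));
    eexists; rewrite cat_rcons.
Qed.

(** This gives the product form of transcript probabilities: each bit is computed from the coins of
    the player whose turn it is, and the condition on the other player is vacuous at that step. *)
Lemma runE x y w n g s : run x y (w : coins pi) n g = g ++ s <->
  coin_rect (live n g s) (agreeA x g s) (agreeB y g s) w.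
Proof.
rewrite /coin_rect /=.
have catI0 t : g = g ++ t <-> t = [::].
  split=> [|->]; last by rewrite cats0.
  by rewrite -{1}(cats0 g) => /eqP; rewrite eqseq_cat// eqxx => /eqP.
elim: n g s catI0 => [|n IHn] g s catI0 /=.
  by rewrite catI0; case: s => [|b s] /=; split => // -[].
have step c b s' : run x y w n (rcons g c) = g ++ b :: s' <->
    c = b /\ run x y w n (rcons g b) = rcons g b ++ s'.
  split=> [|[-> ->]]; last by rewrite cat_rcons.
  have [t rt] := run_extends x y w n (rcons g c).
  rewrite {1}rt cat_rcons => /eqP; rewrite eqseq_cat// eqxx /= => /eqP[cb ts].
  by rewrite -cb rt ts.
(* A run never shortens its history, so a bit once sent stays in it. *)
have run_n0 c : run x y w n (rcons g c) <> g.
  have [t ->] := run_extends x y w n (rcons g c).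
  by rewrite cat_rcons => /esym/catI0.
have IH b s' := IHn (rcons g b) s'.
have {}IH b s' : run x y w n (rcons g b) = rcons g b ++ s' <-> 
  [/\ live n (rcons g b) s' w.1, agreeA x (rcons g b) s' (w.1, w.2.1)
   & agreeB y (rcons g b) s' (w.1, w.2.2)].
  apply: IH => t; split=> [|->]; last by rewrite cats0.
  by rewrite -{1}(cats0 (rcons g b)) => /eqP; rewrite eqseq_cat// eqxx => /eqP.
case: s => [|b s] /=.
  rewrite cats0; case: (turn g w.1) => [[]|]; split=> //.
  - by move=> /run_n0.
  - by case.
  - by move=> /run_n0.
  - by case.
case: (turn g w.1) => [[]|].
- rewrite step IH; split=> [[sb [l a b']]|[[_ l] [sb a] [_ b']]].
    by split; split=> // _.
  by split=> //; exact: sb.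
- rewrite step IH; split=> [[sb [l a b']]|[[_ l] [_ a] [sb b']]].
    by split; split=> // _.
  by split=> //; exact: sb.
- by rewrite catI0; split=> // -[[]].
Qed.

Lemma measurable_live n g s : measurable (live n g s).
Proof.
have mturn h o : measurable [set r | @turn _ _ _ _ pi h r = o].
  exact: (turn_measurable pi h o).
elim: n g s => [|n IHn] g [|b s] //=.
by apply: measurableI => //; exact/measurableC/mturn.
Qed.

Lemma measurable_agreeA x g s : measurable (agreeA x g s).
Proof.
elim: s g => [|b s IHs] g /=; first exact: measurableT.
apply: measurableI => //.
rewrite (_ : mkset _ = ~` (fst @^-1` (turn g @^-1` [set Some Alice])) `|`
    sendA x g @^-1` [set b]).
  apply: measurableU; last exact: sendA_measurable.
  apply: measurableC; rewrite -[X in measurable X]setTI.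
  by apply: measurable_fst => //; exact: turn_measurable.
apply/seteqP; split=> w /=; last by case.
by have [?|] := pselect (turn g w.1 = Some Alice) => sb; [right; exact: sb|left].
Qed.

Lemma measurable_agreeB y g s : measurable (agreeB y g s).
Proof.
elim: s g => [|b s IHs] g /=; first exact: measurableT.
apply: measurableI => //.
rewrite (_ : mkset _ = ~` (fst @^-1` (turn g @^-1` [set Some Bob])) `|`
    sendB y g @^-1` [set b]).
  apply: measurableU; last exact: sendB_measurable.
  apply: measurableC; rewrite -[X in measurable X]setTI.
  by apply: measurable_fst => //; exact: turn_measurable.
apply/seteqP; split=> w /=; last by case.
by have [?|] := pselect (turn g w.1 = Some Bob) => sb; [right; exact: sb|left].
Qed.

Definition coin_prob : probability (pubT pi * (privAT pi * privBT pi))%type R :=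
  (pubP pi \x (privAP pi \x privBP pi))%E.

Implicit Types D O : set (pubT pi * seq bool).

(** Bit strings form a countable discrete space, so measurability can be tested one string at a
    time. *)
Definition measurable_transcripts D := forall h, measurable [set r | D (r, h)].

Definition transcript_event x y D : set (coins pi) :=
  [set w | D (transcript x y w)].

(** The coins that produce exactly the bits [h] with a transcript in [D]; every transcript event is
    a countable union of these. *)
Let rect x y D h := coin_rect (live (depth pi) [::] h `&` [set r | D (r, h)])
  (agreeA x [::] h) (agreeB y [::] h).

Let transcript_eventE x y D :
  transcript_event x y D = \bigcup_h rect x y D h.
Proof.
apply/seteqP; split=> w.
  move=> Dw; exists (run x y w (depth pi) [::]) => //.
  have /runE[? ? ?] : run x y w (depth pi) [::] =
    [::] ++ run x y w (depth pi) [::] by [].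
  by split.
move=> [h _ [[l Dh] a b]]; rewrite /transcript_event /transcript /=.
suff -> : run x y w (depth pi) [::] = [::] ++ h by [].
by apply/runE.
Qed.

Let measurable_rect x y D h :
  measurable_transcripts D -> measurable (rect x y D h).
Proof.
move=> mD; apply: measurable_coin_rect.
- by apply: measurableI => //; exact: measurable_live.
- exact: measurable_agreeA.
- exact: measurable_agreeB.
Qed.

Lemma measurable_transcript_event x y D : measurable_transcripts D ->
  measurable (transcript_event x y D).
Proof.
move=> mD; rewrite transcript_eventE.
apply: countable_bigcupT_measurable => [|h]; first exact: countableP.
exact: measurable_rect.
Qed.

(** The set [a_x > 0], where [a_x] is Alice's factor in the probability of a transcript given the
    public string; it does not involve Bob's input. *)
Definition compatA x : set (pubT pi * seq bool) :=
  [set t | (0 < privAP pi (xsection (agreeA x [::] t.2) t.1))%E].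

Definition compatB y : set (pubT pi * seq bool) :=
  [set t | (0 < privBP pi (xsection (agreeB y [::] t.2) t.1))%E].

Lemma measurable_compatA x : measurable_transcripts (compatA x).
Proof.
move=> h; rewrite -[X in measurable X]setTI.
apply: emeasurable_fun_o_infty => //.
apply: measurable_fun_xsection; exact: measurable_agreeA.
Qed.

Lemma measurable_compatB y : measurable_transcripts (compatB y).
Proof.
move=> h; rewrite -[X in measurable X]setTI.
apply: emeasurable_fun_o_infty => //.
apply: measurable_fun_xsection; exact: measurable_agreeB.
Qed.

Lemma measurable_transcriptsC D :
  measurable_transcripts D -> measurable_transcripts (~` D).
Proof. by move=> mD h; exact/measurableC/mD. Qed.

Lemma measurable_transcriptsI D O : measurable_transcripts D ->
  measurable_transcripts O -> measurable_transcripts (D `&` O).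
Proof. by move=> mD mO h; apply: measurableI; [exact: mD|exact: mO]. Qed.

Lemma measurable_transcriptsU D O : measurable_transcripts D ->
  measurable_transcripts O -> measurable_transcripts (D `|` O).
Proof. by move=> mD mO h; apply: measurableU; [exact: mD|exact: mO]. Qed.

Local Notation PrE x y D := (Pr (transcript_event x y D)).

Lemma Pr_ge0 (E : set (coins pi)) : 0 <= Pr E.
Proof. exact: (fine_ge0 (measure_ge0 coin_prob _)). Qed.

Lemma Pr_transcriptC x y D : measurable_transcripts D ->
  PrE x y (~` D) = 1 - PrE x y D.
Proof.
move=> /(measurable_transcript_event x y).
exact: (fine_probability_setC coin_prob).
Qed.

Lemma Pr_transcriptU x y D O : measurable_transcripts D ->
  measurable_transcripts O -> PrE x y (D `|` O) <= PrE x y D + PrE x y O.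
Proof.
move=> /(measurable_transcript_event x y) + /(measurable_transcript_event x y).
exact: (fine_probabilityU coin_prob).
Qed.

Lemma Pr_transcript_le x y D O : measurable_transcripts D ->
  measurable_transcripts O -> D `<=` O -> PrE x y D <= PrE x y O.
Proof.
move=> /(measurable_transcript_event x y) mD.
move=> /(measurable_transcript_event x y) mO DO.
by apply: (le_fine_probability coin_prob mD mO) => w; exact: DO.
Qed.

Let transcript_event_null x y D : measurable_transcripts D ->
  (forall h, coin_prob (rect x y D h) = 0%E) -> PrE x y D = 0.
Proof.
move=> mD D0; rewrite transcript_eventE.
have null := measure_countable_bigcup0
  (fun h => measurable_rect x y h mD) D0.
exact: (congr1 fine null).
Qed.

(** Transcripts outside [compatA x] come from rectangles whose section on Alice's side is null. *)
Lemma Pr_compatA x y : PrE x y (compatA x) = 1.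
Proof.
have mA := measurable_compatA x.
apply/eqP; rewrite eq_sym -subr_eq0 -Pr_transcriptC//; apply/eqP.
apply: transcript_event_null => [|h]; first exact: measurable_transcriptsC.
apply: coin_rect_null => [||r [_ /negP]].
- exact: measurable_agreeA.
- exact: measurable_agreeB.
- by rewrite -leNgt measure_le0 => /eqP; left.
Qed.

Lemma Pr_compatB x y : PrE x y (compatB y) = 1.
Proof.
have mB := measurable_compatB y.
apply/eqP; rewrite eq_sym -subr_eq0 -Pr_transcriptC//; apply/eqP.
apply: transcript_event_null => [|h]; first exact: measurable_transcriptsC.
apply: coin_rect_null => [||r [_ /negP]].
- exact: measurable_agreeA.
- exact: measurable_agreeB.
- by rewrite -leNgt measure_le0 => /eqP; right.
Qed.

(** At [(x, y)] nullity means that [a_x b_y] vanishes for almost every public string allowing a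
    transcript in [O]. Where both factors are positive, only a null set of public strings remains,
    and the law of the public string is the same for all inputs. *)
Lemma Pr_compat_null x y x' y' O : measurable_transcripts O ->
  PrE x y O = 0 -> PrE x' y' (O `&` (compatA x `&` compatB y)) = 0.
Proof.
move=> mO O0.
have mOAB : measurable_transcripts (O `&` (compatA x `&` compatB y)).
  apply: measurable_transcriptsI => //; apply: measurable_transcriptsI.
    exact: measurable_compatA.
  exact: measurable_compatB.
apply: transcript_event_null => // h.
have rect0 : coin_prob (rect x y O h) = 0%E.
  apply: (@subset_measure0 _ _ _ coin_prob _ (transcript_event x y O)).
  - exact: measurable_rect.
  - exact: measurable_transcript_event.
  - by rewrite transcript_eventE => w ?; exists h.
  - apply: (fine_probability_eq0 _ O0); exact: measurable_transcript_event.
have mlO : measurable (live (depth pi) [::] h `&` [set r | O (r, h)]).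
  by apply: measurableI => //; exact: measurable_live.
have null := coin_rect_null_trans mlO (measurable_agreeA x [::] h)
  (measurable_agreeB y [::] h) (measurable_agreeA x' [::] h)
  (measurable_agreeB y' [::] h) rect0.
(* For fixed bits [h], compatibility is a condition on the public string alone, so it joins the
   public side of the rectangle. *)
rewrite /rect (_ : _ `&` _ = [set r | [/\
    (live (depth pi) [::] h `&` [set r | O (r, h)]) r,
    (0 < privAP pi (xsection (agreeA x [::] h) r))%E &
    (0 < privBP pi (xsection (agreeB y [::] h) r))%E]]); first exact: null.
apply/seteqP; split=> r /=; first by move=> [l [Or [a b]]].
by move=> [[l Or] a b].
Qed.

End ProtocolRectangles.

(** * Cheap protocols *)

Local Notation PrE x y D := (Pr (transcript_event x y D)).

Section InternalCost.
Variables (R : realType) (X Y Z : finType) (pi : protocol R X Y Z).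
Variable mu : X * Y -> R.

Let const_quantizer : quantizer (pi := pi) (fun _ => ord0 : 'I_1).
Proof.
move=> h i; rewrite (_ : mkset _ = setT); first exact: measurableT.
by apply/seteqP; split => // r _; rewrite /= (ord1 i).
Qed.

Let cond_mutual_info_I1 (B C : finType) (p : 'I_1 -> B -> C -> R) :
  cond_mutual_info p = 0.
Proof.
rewrite /cond_mutual_info !cond_entropy_determined ?subrr// => ?;
  by exists ord0 => a _; rewrite (ord1 a).
Qed.

(** The quantization with a single cell contributes 0 to the supremum. *)
Lemma info_X_given_Y_ge0 : (0 <= info_X_given_Y pi mu)%E.
Proof.
apply: ereal_sup_ubound; exists 1%N, (fun _ => ord0).
by split; [exact: const_quantizer|rewrite cond_mutual_info_I1].
Qed.

Lemma info_Y_given_X_ge0 : (0 <= info_Y_given_X pi mu)%E.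
Proof.
apply: ereal_sup_ubound; exists 1%N, (fun _ => ord0).
by split; [exact: const_quantizer|rewrite cond_mutual_info_I1].
Qed.

Lemma internal_cost_ge0 : (0 <= internal_cost pi mu)%E.
Proof. exact: adde_ge0 info_X_given_Y_ge0 info_Y_given_X_ge0. Qed.

Hypothesis mu_ge0 : forall u, 0 <= mu u.

Section EventQuantizer.
Variable D : set (pubT pi * seq bool).
Hypothesis mD : measurable_transcripts D.

(** The quantization into two cells, [D] and its complement. *)
Let q (t : pubT pi * seq bool) : 'I_2 := if `[< D t >] then ord0 else ord_max.

Let q0E x y : [set w | q (transcript x y w) = ord0] = transcript_event x y D.
Proof.
by apply/seteqP; split=> w; rewrite /transcript_event /= /q; case: asboolP.
Qed.

Let q1E x y : [set w | q (transcript x y w) = ord_max] =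
  transcript_event x y (~` D).
Proof.
by apply/seteqP; split=> w; rewrite /transcript_event /= /q; case: asboolP.
Qed.

Let q_quantizer : quantizer q.
Proof.
move=> h i; have [->|i0] := eqVneq i ord0.
  rewrite (_ : mkset _ = [set r | D (r, h)]); first exact: mD.
  by apply/seteqP; split=> r; rewrite /= /q; case: asboolP.
rewrite (_ : mkset _ = [set r | (~` D) (r, h)]).
  exact: (measurable_transcriptsC mD).
have -> : i = ord_max.
  by apply/val_inj => /=; case: i i0 => -[|[|]].
by apply/seteqP; split=> r; rewrite /= /q; case: asboolP.
Qed.

Let P i x y : R := Pr [set w | q (transcript x y w) = i].

Let P_ge0 i x y : 0 <= P i x y. Proof. exact: Pr_ge0. Qed.

Let PE x y : P ord0 x y = PrE x y D. Proof. by rewrite /P q0E. Qed.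

Let P_sum x y : \sum_i P i x y = 1.
Proof.
have i1 : lift ord0 ord0 = ord_max :> 'I_2 by exact/val_inj.
have P1E : P (lift ord0 ord0) x y = 1 - P ord0 x y.
  rewrite i1 /P q1E q0E; exact: Pr_transcriptC.
by rewrite big_ord_recl big_ord1 P1E addrC subrK.
Qed.

(** The bit telling whether the transcript is in [D] reveals at most [e]; it is a channel with input
    [x] and side information [y]. *)
Lemma info_X_given_Y_stable e d k x x' y :
  (info_X_given_Y pi mu <= e%:E)%E -> 4 * (e * ln 2) <= k * d ^+ 2 ->
  0 < k -> 0 <= d -> k <= mu (x, y) -> k <= mu (x', y) ->
  `|PrE x y D - PrE x' y D| <= 2 * d.
Proof.
move=> info_e; rewrite -!PE.
apply: (@channel_stable R 'I_2 X Y (fun x y => mu (x, y)) P) => //.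
rewrite -lee_fin; apply: le_trans info_e; apply: ereal_sup_ubound.
by exists 2, q; split.
Qed.

Lemma info_Y_given_X_stable e d k x y y' :
  (info_Y_given_X pi mu <= e%:E)%E -> 4 * (e * ln 2) <= k * d ^+ 2 ->
  0 < k -> 0 <= d -> k <= mu (x, y) -> k <= mu (x, y') ->
  `|PrE x y D - PrE x y' D| <= 2 * d.
Proof.
move=> info_e; rewrite -!PE.
apply: (@channel_stable R 'I_2 Y X (fun y x => mu (x, y))
  (fun i y x => P i x y)) => //.
rewrite -lee_fin; apply: le_trans info_e; apply: ereal_sup_ubound.
by exists 2, q; split.
Qed.

End EventQuantizer.

End InternalCost.

(** * Connectivity of the support *)

Section SupportGraph.
Variables (R : realType) (X Y : finType) (mu : X * Y -> R).

(** This is the line graph: its vertices in the support are the edges of the bipartite graph,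
    adjacent when they share an endpoint. *)
Definition support_adj : rel (X * Y) := fun u v =>
  [&& mu u != 0, mu v != 0 & (u.1 == v.1) || (u.2 == v.2)].

Lemma support_connect_sym : connect_sym support_adj.
Proof.
apply: sym_connect_sym => u v.
by rewrite /support_adj andbCA !(eq_sym u.1) !(eq_sym u.2).
Qed.

Lemma support_lower_bound : (forall u, 0 <= mu u) ->
  exists2 k : R, 0 < k & forall u, mu u != 0 -> k <= mu u.
Proof.
move=> mu_ge0; exists (\big[Order.min/1]_(u | mu u != 0) mu u).
  by apply: lt_bigmin => // u mu_u; rewrite lt0r mu_u mu_ge0.
by move=> u mu_u; exact: bigmin_le_cond.
Qed.

End SupportGraph.

(** A path without repeated vertices has at most [#|T|] steps; the triangle inequality adds them
    up. *)
Lemma connect_dist_le (R : realDomainType) (T : finType) (e : rel T)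
    (F : T -> R) (d : R) u v :
  (forall a b, e a b -> `|F a - F b| <= d) -> 0 <= d -> connect e u v ->
  `|F u - F v| <= d * #|T|%:R.
Proof.
move=> Fd d0 /connectP[p0 + ->].
case/shortenP => p up /card_uniqP p_uniq _.
have {}p_uniq : (size p <= #|T|)%N.
  by apply: leq_trans (max_card (mem (u :: p))); rewrite p_uniq /=.
apply: (@le_trans _ _ (d * (size p)%:R)); last by rewrite ler_wpM2l// ler_nat.
elim: p u up {p_uniq} => [|a p IHp] u /=; first by rewrite subrr normr0 mulr0.
move=> /andP[/Fd ua /IHp al].
rewrite -natr1 mulrDr mulr1 -(subrKA (F a)).
by rewrite (le_trans (ler_normD _ _))// [leLHS]addrC lerD.
Qed.

(** * From vanishing cost to the block structure *)

Section InternalTrivialStructural.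
Variables (R : realType) (X Y Z : finType) (f : X -> Y -> Z) (mu : X * Y -> R).
Hypothesis mu_ge0 : forall u, 0 <= mu u.

Lemma internal_trivial_approx (e : R) : internal_trivial f mu -> 0 < e ->
  exists2 pi : protocol R X Y Z, computes pi f &
    (info_X_given_Y pi mu <= e%:E)%E /\ (info_Y_given_X pi mu <= e%:E)%E.
Proof.
rewrite /internal_trivial => triv e0.
have : (internal_complexity f mu < e%:E)%E by rewrite triv lte_fin.
move=> /ereal_inf_lt[_ [pi [comp ->]] /ltW cost_e]; exists pi => //.
split; apply: le_trans cost_e; rewrite /internal_cost.
  by rewrite leeDl// info_Y_given_X_ge0.
by rewrite leeDr// info_X_given_Y_ge0.
Qed.

(* If [f x y] differed from [f u], the outputs equal to [f u] would be null at
   [(x, y)], hence so would be, at [u], those compatible with [x] and [y]; but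
   at [u] each of the three conditions has probability at least 3/4. *)
Lemma internal_trivial_rectangle u x y x1 y1 : internal_trivial f mu ->
  connect (support_adj mu) u (x, y1) -> connect (support_adj mu) u (x1, y) ->
  f x y = f u.1 u.2.
Proof.
move=> triv ux uy; apply/eqP/negPn/negP => /eqP f_neq.
have half_lt1 : 1 / 4 + 1 / 4 < 1 :> R by lra.
have [k k0 k_le] := support_lower_bound mu_ge0.
set N : R := #|{: X * Y}|%:R.
have N0 : 0 <= N by rewrite ler0n.
(* With this [d], at most [N] steps of size [2 d] add up to at most 1/4. *)
pose d : R := (8 * (N + 1))^-1.
have d0 : 0 < d by rewrite invr_gt0 mulr_gt0// ltr_wpDl.
have dN : 2 * d * N <= 1 / 4.
  have -> : 2 * d * N = 1 / 4 * (N / (N + 1)).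
    by rewrite /d; field; rewrite gt_eqF// ltr_wpDl.
  by rewrite -[leRHS]mulr1 ler_wpM2l// ler_pdivrMr ?ltr_wpDl// mul1r lerDl.
(* The largest cost allowed by the one-step stability bound for [k] and [d]. *)
pose e := k * d ^+ 2 / (4 * ln 2).
have e0 : 0 < e by rewrite divr_gt0 ?mulr_gt0 ?exprn_gt0// ln2_gt0.
have ek : 4 * (e * ln 2) <= k * d ^+ 2.
  rewrite le_eqVlt; apply/orP; left; apply/eqP; rewrite /e.
  by move: (d) => d1; field; rewrite gt_eqF// ln2_gt0.
have [pi comp [infoX infoY]] := internal_trivial_approx triv e0.
(* A step that keeps [x] uses the information about [Y], a step that keeps [y] the information about
   [X]. *)
have stable D v : measurable_transcripts D -> connect (support_adj mu) u v ->
    `|@Pr _ _ _ _ pi (transcript_event u.1 u.2 D) - PrE v.1 v.2 D| <= 1 / 4.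
  move=> mD uv; apply: le_trans dN.
  apply: (connect_dist_le (F := fun v => PrE v.1 v.2 D)) uv.
    move=> [a b] [a' b'] /and3P[/k_le kab /k_le kab' /= /orP[]/eqP ab].
      rewrite -ab in kab' *.
      exact: (info_Y_given_X_stable mu_ge0 mD infoY ek k0 (ltW d0)).
    rewrite -ab in kab' *.
    exact: (info_X_given_Y_stable mu_ge0 mD infoX ek k0 (ltW d0)).
  by rewrite mulr_ge0// ltW.
pose O z : set (pubT pi * seq bool) := [set t | output t.2 t.1 = z].
have mO z : measurable_transcripts (O z) by move=> h; exact: output_measurable.
have PrO a b : PrE a b (O (f a b)) = 1 by exact: comp.
have mA := measurable_compatA pi x.
have mB := measurable_compatB pi y.
have mAB := measurable_transcriptsI mA mB.
have mOAB := measurable_transcriptsI (mO (f u.1 u.2)) mAB.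
have PrO0 : PrE x y (O (f u.1 u.2)) = 0.
  apply/eqP; rewrite eq_le Pr_ge0 andbT.
  have <- : PrE x y (~` O (f x y)) = 0.
    by rewrite Pr_transcriptC// PrO subrr.
  apply: Pr_transcript_le => //; first exact: measurable_transcriptsC.
  by move=> t; rewrite /O /= => -> /esym.
(* [compatA x] has probability 1 at [(x, y1)], which lies in the component of [u]. *)
have uA : PrE u.1 u.2 (~` @compatA _ _ _ _ pi x) <= 1 / 4.
  have := stable _ _ mA ux.
  rewrite Pr_transcriptC// Pr_compatA distrC.
  exact: le_trans (ler_norm _).
have uB : PrE u.1 u.2 (~` @compatB _ _ _ _ pi y) <= 1 / 4.
  have := stable _ _ mB uy; rewrite Pr_transcriptC// Pr_compatB distrC.
  exact: le_trans (ler_norm _).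
have uO : PrE u.1 u.2 (O (f u.1 u.2) `&` (compatA x `&` compatB y)) = 0.
  exact: Pr_compat_null PrO0.
have u1 : 1 <= PrE u.1 u.2 ((O (f u.1 u.2) `&` (compatA x `&` compatB y)) `|`
    ~` (compatA x `&` compatB y)).
  rewrite -(PrO u.1 u.2); apply: Pr_transcript_le.
  - exact: mO.
  - exact: measurable_transcriptsU mOAB (measurable_transcriptsC mAB).
  - by move=> t Ot; have [|] := pselect ((compatA x `&` compatB y) t);
      [left|right].
have u2 := Pr_transcriptU u.1 u.2 mOAB (measurable_transcriptsC mAB).
have := Pr_transcriptU u.1 u.2 (measurable_transcriptsC mA)
  (measurable_transcriptsC mB).
rewrite -setCI => u3.
have := le_trans u1 u2; rewrite uO add0r => /le_trans/(_ u3).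
by move=> /le_trans/(_ (lerD uA uB)); rewrite leNgt half_lt1.
Qed.

(** The blocks are the two projections of the connected components of the support. *)
Lemma internal_trivial_structural :
  internal_trivial f mu -> structurally_internal_trivial f mu.
Proof.
move=> triv; pose g := support_adj mu.
have symg : connect_sym g := support_connect_sym mu.
pose comp_root := fingraph.root g.
(* Only components of support points are indexed; any other point is isolated and would give empty
   blocks. *)
pose roots := [set comp_root u | u in [pred u | mu u != 0]]%SET.
pose rt (i : 'I_#|roots|) := enum_val i.
pose XX i := [set x | [exists y, (mu (x, y) != 0) && (comp_root (x, y) == rt i)]]%SET.
pose YY i := [set y | [exists x, (mu (x, y) != 0) && (comp_root (x, y) == rt i)]]%SET.
have adjg u v : mu u != 0 -> mu v != 0 -> (u.1 == v.1) || (u.2 == v.2) ->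
    comp_root u = comp_root v.
  move=> mu_u mu_v uv; apply/(fingraph.rootP symg)/connect1.
  by rewrite /g /support_adj mu_u mu_v uv.
have idx u : mu u != 0 -> exists i, comp_root u = rt i.
  move=> mu_u; have ru : comp_root u \in roots by apply: imset_f; rewrite inE.
  by exists (enum_rank_in ru (comp_root u)); rewrite /rt enum_rankK_in.
have rt_edge i : exists2 u, mu u != 0 & comp_root u = rt i.
  have /imsetP[u mu_u iu] := enum_valP i.
  by exists u; [rewrite inE in mu_u|rewrite /rt iu].
have rt_inj i j : rt i = rt j -> i = j by exact: enum_val_inj.
exists #|roots|, XX, YY; split.
- split.
  + move=> i; have [[x y] mxy ri] := rt_edge i; apply/set0Pn; exists x.
    by rewrite inE; apply/existsP; exists y; rewrite mxy ri eqxx.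
  (* Two support points with the same [x] are adjacent, so [x] meets one component only. *)
  + move=> i j ij; apply/setP => x; rewrite !inE; apply/negP.
    move=> /andP[/existsP[y /andP[mxy /eqP ri]]].
    move=> /existsP[y' /andP[mxy' /eqP rj]].
    case/eqP: ij; apply: rt_inj; rewrite -ri -rj.
    by apply: adjg => //=; rewrite eqxx.
  + apply/setP => x; rewrite inE; apply/bigcupP/idP => [[i _]|].
      rewrite inE => /existsP[y /andP[mxy _]].
      by apply: contraNneq mxy => /psumr_eq0P -> //.
    move=> /eqP; apply: contra_notP => noi; apply: big1 => y _.
    apply/eqP/negPn/negP => mxy; apply: noi.
    have [i ri] := idx _ mxy; exists i => //.
    by rewrite inE; apply/existsP; exists y; rewrite mxy ri eqxx.
- split.
  + move=> i; have [[x y] mxy ri] := rt_edge i; apply/set0Pn; exists y.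
    by rewrite inE; apply/existsP; exists x; rewrite mxy ri eqxx.
  + move=> i j ij; apply/setP => y; rewrite !inE; apply/negP.
    move=> /andP[/existsP[x /andP[mxy /eqP ri]]].
    move=> /existsP[x' /andP[mxy' /eqP rj]].
    case/eqP: ij; apply: rt_inj; rewrite -ri -rj.
    by apply: adjg => //=; rewrite eqxx orbT.
  + apply/setP => y; rewrite inE; apply/bigcupP/idP => [[i _]|].
      rewrite inE => /existsP[x /andP[mxy _]].
      by apply: contraNneq mxy => /psumr_eq0P -> //.
    move=> /eqP; apply: contra_notP => noi; apply: big1 => x _.
    apply/eqP/negPn/negP => mxy; apply: noi.
    have [i ri] := idx _ mxy; exists i => //.
    by rewrite inE; apply/existsP; exists x; rewrite mxy ri eqxx.
- move=> x y mxy; have [i ri] := idx _ mxy; exists i.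
  by rewrite !inE; split; apply/existsP; [exists y|exists x];
    rewrite mxy ri eqxx.
- move=> i x x' y y' xi xi' yi yi'.
  have [u mu_u ui] := rt_edge i.
  suff rect a b : a \in XX i -> b \in YY i -> f a b = f u.1 u.2.
    by rewrite !rect.
  rewrite !inE => /existsP[b1 /andP[_ /eqP ra]] /existsP[a1 /andP[_ /eqP rb]].
  by apply: (internal_trivial_rectangle triv); apply/(fingraph.rootP symg);
    [exact: etrans ui (esym ra)|exact: etrans ui (esym rb)].
Qed.

End InternalTrivialStructural.

(** * The block protocol *)

Section BlockProtocol.
Variables (R : realType) (X Y Z : finType) (f : X -> Y -> Z).
Variables (k : nat) (XX : 'I_k -> {set X}) (YY : 'I_k -> {set Y}).
Variables (x0 : X) (y0 : Y).

Let cA (x : X) : seq bool := [seq x \in XX i | i <- enum 'I_k].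
Let cB (y : Y) : seq bool := [seq y \in YY i | i <- enum 'I_k].
Let eX (x : X) : seq bool := [seq x == x' | x' <- enum X].
Let eY (y : Y) : seq bool := [seq y == y' | y' <- enum Y].

Let size_cA x : size (cA x) = k. Proof. by rewrite size_map size_enum_ord. Qed.
Let size_cB y : size (cB y) = k. Proof. by rewrite size_map size_enum_ord. Qed.
Let size_eX x : size (eX x) = #|X|. Proof. by rewrite size_map -cardE. Qed.
Let size_eY y : size (eY y) = #|Y|. Proof. by rewrite size_map -cardE. Qed.

Let eX_inj : injective eX.
Proof.
move=> x x' /eq_in_map/(_ x (mem_enum _ _)).
by rewrite eqxx => /esym/eqP.
Qed.

Let eY_inj : injective eY.
Proof.
move=> y y' /eq_in_map/(_ y (mem_enum _ _)).
by rewrite eqxx => /esym/eqP.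
Qed.

Let full x y := cA x ++ cB y ++ eX x ++ eY y.

Let len := (k + (k + (#|X| + #|Y|)))%N.

Let size_full x y : size (full x y) = len.
Proof. by rewrite !size_cat size_cA size_cB size_eX size_eY. Qed.

(** The announced indicator vectors agree and are not zero. The zero vector must be excluded: two
    inputs outside all blocks would agree as well. *)
Let settled (h : seq bool) := has id (take k h) && (take k h == take k (drop k h)).

Let block_turn (h : seq bool) : option player :=
  if (size h < k)%N then Some Alice
  else if (size h < k + k)%N then Some Bob
  else if settled h then None
  else if (size h < k + (k + #|X|))%N then Some Alice
  else if (size h < len)%N then Some Bob
  else None.

Let stop x y := if settled (full x y) then (k + k)%N else len.

Let trace x y := take (stop x y) (full x y).

(** Decodes through any input pair with trace [h]; the default value serves strings that are no
    trace. *)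
Let block_output (h : seq bool) : Z :=
  if [pick u : X * Y | trace u.1 u.2 == h] is Some u then f u.1 u.2
  else f x0 y0.

Let block_turn_depth h : (len <= size h)%N -> block_turn h = None.
Proof.
rewrite /block_turn /len => lh.
by do 2?[rewrite ifF; last by lia]; case: ifP => // _;
  do 2?[rewrite ifF; last by lia].
Qed.

Let measurable_preimage_cst d (T : measurableType d) (U : Type) (a : U)
  (B : set U) : measurable ((fun _ : T => a) @^-1` B).
Proof. by rewrite preimage_cst; case: ifP. Qed.

(* No coins are tossed.  Alice and Bob announce the indicator vectors of their
   blocks, and, unless these designate a common block, their inputs. *)
Definition block_protocol : protocol R X Y Z := @Protocol R X Y Z
  _ _ _ unit unit unit (dirac tt) (dirac tt) (dirac tt) len
  (fun h _ => block_turn h)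
  (fun x h _ => nth false (full x y0) (size h))
  (fun y h _ => nth false (full x0 y) (size h))
  (fun h _ => block_output h)
  (fun h _ => @block_turn_depth h)
  (fun h o => @measurable_preimage_cst _ unit _ _ _)
  (fun x h b => @measurable_preimage_cst _ (unit * unit)%type _ _ _)
  (fun y h b => @measurable_preimage_cst _ (unit * unit)%type _ _ _)
  (fun h z => @measurable_preimage_cst _ unit _ _ _).

Let take_cA x y n : (k <= n)%N -> take k (take n (full x y)) = cA x.
Proof.
by move=> kn; rewrite take_takel// take_size_cat.
Qed.

Let take_cB x y n : (k + k <= n)%N ->
  take k (drop k (take n (full x y))) = cB y.
Proof.
by move=> kn; rewrite take_drop take_takel// -take_drop drop_size_cat//
  take_size_cat.
Qed.

Let settled_take x y n : (k + k <= n)%N ->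
  settled (take n (full x y)) = settled (full x y).
Proof.
move=> kn; rewrite /settled take_cA ?take_cB//; last by lia.
have -> : full x y = take len (full x y) by rewrite take_oversize ?size_full.
by rewrite take_cA ?take_cB// /len; lia.
Qed.

(** At Alice's positions the bits depend on [x] only, so the placeholder [y0] in her messages is
    harmless. *)
Let nth_A x y n : (n < k)%N || (k + k <= n < k + (k + #|X|))%N ->
  nth false (full x y0) n = nth false (full x y) n.
Proof.
move=> n_A; rewrite /full !nth_cat !size_cA !size_cB !size_eX.
by case: ifP => // ?; case: ifP => ?; [lia|case: ifP => // ?; lia].
Qed.

Let nth_B x y n : (k <= n < k + k)%N || (k + (k + #|X|) <= n)%N ->
  nth false (full x0 y) n = nth false (full x y) n.
Proof.
move=> n_A; rewrite /full !nth_cat !size_cA !size_cB !size_eX.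
by case: ifP => ?; [lia|case: ifP => // ?; case: ifP => // ?; lia].
Qed.

Let stop_le x y : (stop x y <= len)%N.
Proof. by rewrite /stop /len; case: ifP => _; lia. Qed.

(** Invariant of the run: after [j] bits the history is the prefix of length [j] of the full
    message, and [n] is the remaining budget. *)
Let run_full x y w n j : (n + j = len)%N -> (j <= stop x y)%N ->
  run x y (w : coins block_protocol) n (take j (full x y)) = trace x y.
Proof.
elim: n j => [|n IHn] j nj j_stop.
  have jl : j = len by [].
  congr (take _ _); apply/eqP; rewrite eqn_leq j_stop jl; exact: stop_le.
have j_lt : (j < len)%N by rewrite -nj addSn ltnS leq_addl.
have sj : size (take j (full x y)) = j.
  by rewrite size_take size_full j_lt.
have step : rcons (take j (full x y)) (nth false (full x y) j) =
    take j.+1 (full x y) by rewrite -take_nth ?size_full.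
rewrite /= {1}/block_turn sj.
have nj1 : (n + j.+1 = len)%N by rewrite addnS.
have stop_ge : (k + k <= stop x y)%N.
  by rewrite /stop /len; case: ifP => _; lia.
case: ifP => [jk|jk].
  by rewrite (nth_A x y) ?jk// step IHn//; lia.
case: ifP => [jkk|jkk].
  by rewrite (nth_B x y) ?step ?IHn//; lia.
rewrite settled_take; last by lia.
case: ifP => [st|st].
  (* Here [j] is at least [k + k], and [stop x y] is [k + k], so they coincide. *)
  congr take; move: j_stop; rewrite /stop st; lia.
have jS : (j.+1 <= stop x y)%N by rewrite /stop st.
case: ifP => [jx|jx].
  by rewrite (nth_A x y) ?step ?IHn//; lia.
by rewrite j_lt (nth_B x y) ?step ?IHn//; lia.
Qed.

Let transcript_trace x y w :
  transcript x y (w : coins block_protocol) = (w.1, trace x y).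
Proof.
by rewrite /transcript -(run_full w (addn0 len) (leq0n (stop x y))) take0.
Qed.

Hypotheses (XX_disj : forall i j, i != j -> (XX i :&: XX j)%SET = finset.set0)
  (YY_disj : forall i j, i != j -> (YY i :&: YY j)%SET = finset.set0)
  (f_cst : forall i x x' y y', x \in XX i -> x' \in XX i ->
    y \in YY i -> y' \in YY i -> f x y = f x' y').

(** A settled trace places both pairs in one rectangle of blocks, where [f] is constant; any other
    trace contains the inputs themselves. *)
Let trace_inj x y x' y' : trace x y = trace x' y' -> f x y = f x' y'.
Proof.
move=> tr.
have kk a b : (k + k <= stop a b)%N.
  by rewrite /stop /len; case: ifP => _; lia.
have k1 a b : (k <= stop a b)%N by have := kk a b; lia.
have eA : cA x = cA x'.
  by rewrite -(take_cA x y (k1 x y)) -(take_cA x' y' (k1 x' y')) -/(trace _ _) tr.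
have eB : cB y = cB y'.
  by rewrite -(take_cB x y (kk x y)) -(take_cB x' y' (kk x' y')) -/(trace _ _) tr.
have st : settled (full x y) = settled (full x' y').
  rewrite -(settled_take x y (kk x y)) -(settled_take x' y' (kk x' y')).
  by rewrite -!/(trace _ _) tr.
move: tr; rewrite /trace /stop st; case: ifP => [s _|_].
  move: s; rewrite -st -(settled_take x y (leqnn _)) /settled.
  rewrite take_cA ?leq_addr// take_cB// => /andP[/hasP[_ /mapP[i _ ->] xi]].
  move=> /eqP eAB.
  have yi : y \in YY i.
    have /eq_in_map/(_ i (mem_enum _ _)) <- := eAB; exact: xi.
  have xi' : x' \in XX i.
    by have /eq_in_map/(_ i (mem_enum _ _)) <- := eA.
  have yi' : y' \in YY i.
    by have /eq_in_map/(_ i (mem_enum _ _)) <- := eB.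
  exact: (f_cst xi).
rewrite !take_oversize ?size_full// => /eqP.
rewrite /full eA eB eqseq_cat// eqseq_cat// !eqxx /= eqseq_cat ?size_eX//.
by move=> /andP[/eqP/eX_inj -> /eqP/eY_inj ->].
Qed.

Lemma block_protocol_computes : computes block_protocol f.
Proof.
move=> x y; rewrite (_ : mkset _ = setT).
  by rewrite /Pr (probability_setT (coin_prob block_protocol)).
apply/seteqP; split=> // w _; rewrite /mkset /result transcript_trace /=.
rewrite /block_output; case: pickP => [u /eqP/trace_inj //|/(_ (x, y))].
by rewrite eqxx.
Qed.

Variable mu : X * Y -> R.
Hypothesis mu_blocks : forall x y, mu (x, y) != 0 ->
  exists i, x \in XX i /\ y \in YY i.

(** By disjointness both vectors are the indicator of the common block, so either player can predict
    the whole trace. *)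
Let trace_support x y : mu (x, y) != 0 ->
  trace x y = cA x ++ cA x /\ trace x y = cB y ++ cB y.
Proof.
move=> /mu_blocks[i [xi yi]].
have eAB : cA x = cB y.
  apply/eq_in_map => j _; have [->|ji] := eqVneq j i; first by rewrite xi yi.
  have /setP/(_ x) := XX_disj ji; have /setP/(_ y) := YY_disj ji.
  by rewrite !inE xi yi !andbT => -> ->.
have st : settled (full x y).
  rewrite -(settled_take x y (leqnn _)) /settled.
  rewrite take_cA ?leq_addr// take_cB// eAB eqxx andbT -eAB.
  by apply/hasP; exists true => //; apply/mapP; exists i; rewrite ?mem_enum.
rewrite /trace /stop st; have -> : take (k + k) (full x y) = cA x ++ cB y.
  by rewrite /full catA take_size_cat// size_cat size_cA size_cB.
by rewrite eAB.
Qed.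

Let law_neq0 n (q : pubT block_protocol * seq bool -> 'I_n) i x y :
  quantized_law mu q i x y != 0 -> mu (x, y) != 0 /\ i = q (tt, trace x y).
Proof.
rewrite /quantized_law mulf_eq0 negb_or => /andP[mxy P0]; split => //.
apply/eqP; apply: contraNT P0 => iq; rewrite (_ : mkset _ = set0).
  by rewrite /Pr (measure0 (coin_prob block_protocol)).
apply/seteqP; split => // w /=; rewrite transcript_trace => qi.
by case/eqP: iq; rewrite -qi; case: (w.1).
Qed.

(** On the support the transcript is determined by either input alone, so both conditional entropies
    in each mutual information vanish. *)
Lemma block_protocol_cost : internal_cost block_protocol mu = 0%E.
Proof.
rewrite /internal_cost.
have -> : info_X_given_Y block_protocol mu = 0%E.
  apply/eqP; rewrite eq_le info_X_given_Y_ge0 andbT.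
  apply: ge_ereal_sup => _ [n [q [_ ->]]].
  rewrite lee_fin /cond_mutual_info !cond_entropy_determined ?subrr//.
    move=> [x y]; exists (q (tt, trace x y)) => i /=.
    by move=> /law_neq0[].
  move=> y; exists (q (tt, cB y ++ cB y)) => i.
  apply: contra_neq_eq => iq; apply: big1 => x _; apply/eqP; apply: contraNT iq.
  by move=> /law_neq0[/trace_support[_ <-] ->].
have -> : info_Y_given_X block_protocol mu = 0%E.
  apply/eqP; rewrite eq_le info_Y_given_X_ge0 andbT.
  apply: ge_ereal_sup => _ [n [q [_ ->]]].
  rewrite lee_fin /cond_mutual_info !cond_entropy_determined ?subrr//.
    move=> [y x]; exists (q (tt, trace x y)) => i /=.
    by move=> /law_neq0[].
  move=> x; exists (q (tt, cA x ++ cA x)) => i.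
  apply: contra_neq_eq => iq; apply: big1 => y _; apply/eqP; apply: contraNT iq.
  by move=> /law_neq0[/trace_support[<- _] ->].
by rewrite adde0.
Qed.

End BlockProtocol.

(** * The cycle of implications between the three notions *)

Theorem mainTheorem15 (R : realType) (X Y Z : finType) (f : X -> Y -> Z)
  (mu : X * Y -> R) (hmu : is_distribution mu) :
  (internal_trivial f mu <-> strongly_internal_trivial f mu) /\
  (strongly_internal_trivial f mu <-> structurally_internal_trivial f mu).
Proof.
have [mu_ge0 mu1] := hmu.
have a_c := @internal_trivial_structural R X Y Z f mu mu_ge0.
have b_a : strongly_internal_trivial f mu -> internal_trivial f mu.
  move=> [pi [comp cost0]]; apply/eqP; rewrite eq_le; apply/andP; split.
    by apply: ereal_inf_lbound; exists pi.
  by apply: le_ereal_inf_tmp => _ [pi' [_ ->]]; exact: internal_cost_ge0.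
have c_b : structurally_internal_trivial f mu -> strongly_internal_trivial f mu.
  move=> [k [XX [YY [[_ dXX _] [_ dYY _] supp fcst]]]].
  (* Total mass 1 provides a pair of inputs to serve as placeholders. *)
  have [[x0 y0] _] : exists u, mu u != 0.
    apply/not_existsP => mu0; have : (1 : R) = 0.
      by rewrite -mu1; apply: big1 => u _; apply/eqP/negPn/negP/mu0.
    by apply/eqP/oner_neq0.
  exists (block_protocol R f XX YY x0 y0); split.
    exact: block_protocol_computes.
  exact: block_protocol_cost.
by split; split; [move/a_c/c_b|exact: b_a|move/b_a/a_c|].
Qed.
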